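(* Let $C = (m\mathbb{N} + A) \cup B \cup F$ be an eventually periodic set of period $m$. If $m$ is prime and $C$ arises as a minimal additive complement in $\mathbb{Z}$, then $$|A_{(m)}| \leq \frac{|F_{(m)}|}{2|F_{(m)}| + 1} (m+1).$$ Moreover, if $m$ is prime, $C$ arises as a minimal additive complement in $\mathbb{Z}$, and $|A_{(m)}| > \frac{|F_{(m)}|}{2|F_{(m)}| + 1}m$, then for each $a \in A_{(m)}$ there is some $W\subseteq\mathbb{Z}$ such that $(m\mathbb{Z} + a) \cap (\mathbb{Z} \setminus C) = (m \mathbb{Z} + a) \cap (F + W)$.
   Context: $\mathbb{N}=\{1,2,3,\dots\}$. For $S\subseteq\mathbb{Z}$, $S_{(m)}$ denotes the image of $S$ in $\mathbb{Z}/m\mathbb{Z}$ under the standard projection; for $a\in\mathbb{Z}/m\mathbb{Z}$, $m\mathbb{Z}+a$ denotes the corresponding residue class, viewed as a subset of $\mathbb{Z}$. Sums of sets are Minkowski sums. $C\subseteq\mathbb{Z}$ arises as a minimal additive complement if there is $W\subseteq\mathbb{Z}$ with $C+W=\mathbb{Z}$ and $C'+W\neq\mathbb{Z}$ for every proper subset $C'\subsetneq C$. An eventually periodic set of period $m$ is a set of integers of the form $(m\mathbb{N}+A)\cup B\cup F$, where $A$ is nonempty, $B$ and $F$ are finite, $B_{(m)}\subseteq A_{(m)}$ and $F_{(m)}\cap A_{(m)}=\emptyset$. It is assumed throughout that the representation is normalized so that $(m,A,B,F)$ is unique: $m$ is the minimal period, $A$ has at most one element in each residue class modulo $m$, and $b\notin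 A+m\mathbb{Z}_{\ge 0}$ for every $b\in B$. *)

(* Defs.v *)
From mathcomp Require Import all_boot all_order all_algebra.
From mathcomp Require Import boolp classical_sets cardinality.

Set Implicit Arguments.
Unset Strict Implicit.
Unset Printing Implicit Defensive.

Import Order.TTheory GRing.Theory Num.Theory.

Local Open Scope classical_set_scope.
Local Open Scope ring_scope.

Definition sumset (S T : set int) : set int :=
  [set s + t | s in S & t in T].

(* Z/mZ for every m >= 1. We avoid 'Z_m, which is Z/2Z when m = 1: the period
   m = 1 must be treated correctly when stating that a period is minimal.
   The value at m = 0 is junk and never used. *)
Definition Zmod (m : nat) : finType := 'I_m.-1.+1.

Definition Zproj (m : nat) (x : int) : Zmod m := inZp `|(x %% m%:Z)%Z|%N.

Definition residues (m : nat) (S : set int) : set (Zmod m) := Zproj m @` S.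
Arguments residues m S : clear implicits.

Definition residue_class (m : nat) (a : Zmod m) : set int :=
  Zproj m @^-1` [set a].

Definition is_minimal_complement (C W : set int) : Prop :=
  sumset C W = setT /\
  forall C' : set int, C' `<` C -> sumset C' W <> setT.

Definition arises_as_minimal_complement (C : set int) : Prop :=
  exists W : set int, is_minimal_complement C W.

(* The natural numbers start at 1 here, so a in A does not itself belong to
   pos_multiples m + A through the summand 0. *)
Definition pos_multiples (m : nat) : set int :=
  [set (m * k)%N%:Z | k in [set k : nat | (0 < k)%N]].

Definition nonneg_multiples (m : nat) : set int :=
  [set (m * k)%N%:Z | k in [set: nat]].

Definition ep_set (m : nat) (A B F : set int) : set int :=
  sumset (pos_multiples m) A `|` B `|` F.

Definition ep_data (m : nat) (A B F : set int) : Prop :=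
  [/\ (0 < m)%N,
      A !=set0,
      finite_set B /\ finite_set F,
      residues m B `<=` residues m A &
      residues m F `&` residues m A = set0].

Definition has_period (C : set int) (m : nat) : Prop :=
  exists A B F : set int, ep_data m A B F /\ C = ep_set m A B F.

(* Normalization makes (m, A, B, F) unique: m is the least period, and each
   a in A is the largest integer of its class mod m missing from the set. *)
Definition ep_normalized (m : nat) (A B F : set int) : Prop :=
  [/\ ep_data m A B F,
      forall m' : nat, has_period (ep_set m A B F) m' -> (m <= m')%N,
      forall a a' : int, A a -> A a' -> Zproj m a = Zproj m a' -> a = a' &
      forall b : int, B b -> ~ sumset A (nonneg_multiples m) b].

(* Main.v *)
(* Let C + W = Z be minimal and let U be the set of residues in which W is
   unbounded below. An integer with residue in A + U has infinitely many
   representations, so the uniquely represented integers that witness minimality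
   have residue in the complement T of A + U. Very negative integers with residue
   in T can only be reached from F, so T lies in F + U and |T| <= |F| |U|.
   Letting c run to infinity in a class a of A, the witness of c yields t in T
   such that a single element w of W leads from the classes of A to t, and w has
   residue t - a; hence a |-> t is injective and |A| <= |T|. Cauchy-Davenport
   gives |A| + |U| - 1 <= m - |T|, which is the bound. When |A| > f m / (2 f + 1)
   with f = |F|, the same inequalities force |T| = |A|, so the witnesses of all
   elements of C in the class a use the single w attached to a, and the integers
   of that class outside C are exactly those in F + (W - w). *)
Require Import Defs.
From mathcomp Require Import all_boot all_order all_algebra zify.
From mathcomp Require Import boolp classical_sets cardinality.

Import Order.TTheory GRing.Theory Num.Theory.

Local Open Scope classical_set_scope.
Local Open Scope ring_scope.

(** * Sumsets in a finite abelian group and the Cauchy-Davenport inequality *)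

Definition fsum {G : finZmodType} (S T : {set G}) : {set G} :=
  ([set x + y | x in S, y in T])%SET.

(* The hypothesis says that G has no proper nontrivial subgroup. Induction on
   #|T| via the Dyson e-transform: T is replaced by its intersection with S - e,
   and S by its union with T + e. *)
Lemma cauchy_davenport {G : finZmodType}
    (hG : forall (S : {set G}) d, d != 0 -> S != finset.set0 ->
       (forall x, x \in S -> x + d \in S) -> S = [set: G]%SET)
    (S T : {set G}) :
  S != finset.set0 -> T != finset.set0 -> fsum S T != [set: G]%SET ->
  (#|S| + #|T| <= #|fsum S T|.+1)%N.
Proof.
have [n] := ubnP #|T|; elim: n S T => // n IHn S T ltTn S0 T0 ST.
have [/existsP [e /andP[meet /subsetPn[y yT yS]]]|noe] :=
  boolP [exists e, ((T :&: [set y | (y + e)%R \in S]) != finset.set0) &&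
     ~~ (T \subset [set y | (y + e)%R \in S])]%SET.
- set T' := (T :&: [set y | (y + e)%R \in S])%SET in meet.
  set T'' := (T :\: [set y | (y + e)%R \in S])%SET.
  set S' := (S :|: [set (y + e)%R | y in T''])%SET.
  have cT : (#|T'| + #|T''| = #|T|)%N by rewrite cardsID.
  have cT'' : (0 < #|T''|)%N.
    by apply/card_gt0P; exists y; rewrite !finset.inE yT andbT; move: yS; rewrite finset.inE.
  have cS : (#|S'| = #|S| + #|T''|)%N.
    rewrite cardsU (_ : (_ :&: _)%SET = finset.set0) ?cards0 ?subn0.
      by rewrite card_imset //; exact: addIr.
    apply/finset.setP => x; rewrite !finset.inE; apply/negP => /andP[xS /imsetP[z]].
    by rewrite !finset.inE => /andP[/negP zS _] xz; apply: zS; rewrite -xz.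
  (* An added element [z + e] plus [t] equals [(t + e) + z], and [t + e] lies in [S]. *)
  have sub : fsum S' T' \subset fsum S T.
    apply/fintype.subsetP => x /imset2P[s t]; rewrite !finset.inE => s_in /andP[tT tS] ->.
    case/orP: s_in => [sS|/imsetP[z]]; first by apply/imset2P; exists s t.
    rewrite !finset.inE => /andP[_ zT] ->.
    by apply/imset2P; exists (t + e) z => //; rewrite addrC addrCA addrC.
  have S'0 : S' != finset.set0.
    by rewrite -card_gt0 cS; rewrite -card_gt0 in S0; lia.
  have := IHn S' T' _ S'0 meet _.
  have := subset_leq_card sub; rewrite cS.
  have ST' : fsum S' T' != [set: G]%SET.
    by apply: contra ST => /eqP eqT; rewrite eqT finset.subTset in sub.
  move=> le1 /(_ _ ST') le2; have : (#|T'| < n)%N by lia.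
  by move=> /le2; lia.
(* With [e = s - t] the translate [S - e] meets [T] at [t], so it contains all of [T]: [S] is stable
   under differences of elements of [T]. *)
- have {}noe s t t' : s \in S -> t \in T -> t' \in T -> s + (t' - t) \in S.
    move=> sS tT t'T; apply: contraNT noe => sN; apply/existsP; exists (s - t).
    apply/andP; split.
      by apply/finset.set0Pn; exists t; rewrite !finset.inE tT addrC subrK.
    by apply/subsetPn; exists t' => //; rewrite finset.inE addrCA.
  have [t tT] := finset.set0Pn _ T0.
  have cS : (#|S| <= #|fsum S T|)%N.
    rewrite -(card_imset S (addIr t)); apply: subset_leq_card.
    by apply/fintype.subsetP => x /imsetP[s sS ->]; apply/imset2P; exists s t.
  have [le1|] := leqP #|T| 1; first by lia.
  case/card_gt1P => t1 [t2 [t1T t2T ne]]; have dn : t2 - t1 != 0.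
    by rewrite subr_eq0 eq_sym.
  have ST1 := hG S _ dn S0 (fun s sS => noe s t1 t2 sS t1T t2T).
  move: cS ST; rewrite ST1 cardsT => cS /negP[]; rewrite eqEcard finset.subsetT.
  by rewrite cardsT.
Qed.

(** * Residues in which the complement is unbounded below *)

Lemma uniform_threshold {G : finType} (P : G -> int -> Prop) :
  (forall g, exists K, forall x, K <= x -> P g x) ->
  exists K, forall g x, K <= x -> P g x.
Proof.
move=> /choice [K hK]; exists (\sum_g `|K g|) => g x le_x; apply: hK.
apply: le_trans (ler_norm _) (le_trans _ le_x).
by rewrite (bigD1 g) //= lerDl sumr_ge0.
Qed.

Definition unbounded_residues {G : finZmodType} (pr : int -> G) (W : set int) :
    {set G} :=
  [set r | `[< forall N, exists w, [/\ W w, pr w = r & w < N] >]]%SET.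

(** Each residue outside the set has its own lower bound in [W]; there are finitely many residues,
    so one bound serves all. *)
Lemma unbounded_residuesP {G : finZmodType} (pr : int -> G) (W : set int) :
  exists N, forall w, W w -> w < N -> pr w \in unbounded_residues pr W.
Proof.
have [|K hK] := @uniform_threshold G (fun g x =>
    forall w, W w -> pr w = g -> w < - x -> g \in unbounded_residues pr W).
  move=> g; have [gU|/existsNP[N hN]] :=
    asboolP (forall N, exists w, [/\ W w, pr w = g & w < N]).
    by exists 0 => *; rewrite finset.inE; apply/asboolP.
  exists (- N) => x Nx w Ww pw wx; case: hN; exists w; split => //.
  by lia.
by exists (- K) => w Ww wN; apply: (hK _ K _ w).
Qed.

(** Removing [c] leaves some [z] uncovered, so every representation of [z] uses [c]; take
    [w = z - c]. *)
Lemma unique_representation {C W : set int} (hCW : is_minimal_complement C W) c :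
  C c -> exists2 w, W w &
    forall c' w', C c' -> W w' -> c' + w' = c + w -> c' = c.
Proof.
move: hCW => [CW minC] Cc.
have [z nz] : exists z, ~ sumset (C `\ c) W z.
  apply/existsNP => all_z; apply: (minC (C `\ c)).
    by split=> [x []//|/(_ _ Cc)[_]]; apply.
  by apply/seteqP; split => z // _; apply: all_z.
have [c0 Cc0 [w Ww zE]] : sumset C W z by rewrite CW.
have uniq c' w' : C c' -> W w' -> c' + w' = z -> c' = c.
  move=> Cc' Ww' e; apply: contrapT => ne; apply: nz.
  by exists c' => //; exists w'.
exists w => // c' w' Cc' Ww'; rewrite -(uniq _ _ Cc0 Ww zE) zE.
by rewrite (uniq _ _ Cc0 Ww zE); exact: uniq.
Qed.

(** The features of an eventually periodic set on which the counting rests, for any projection [pr]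
    to a finite group. *)
Definition eventually_full {G : finZmodType} (pr : int -> G) (C : set int)
    (A F : {set G}) : Prop :=
  [/\ forall g N, (exists2 z, pr z = g & z < N),
      exists lo, forall c, C c -> lo <= c,
      exists hi, forall x, pr x \in A -> hi <= x -> C x &
      forall c, C c -> pr c \in (A :|: F)%SET].

(* An element in a residue class of A + U has infinitely many representations,
   since w can be taken arbitrarily negative. *)
Lemma unique_residue {G : finZmodType} {pr : {additive int -> G}}
    {C W : set int} {A F : {set G}} (hC : eventually_full pr C A F) c w :
  (forall c' w', C c' -> W w' -> c' + w' = c + w -> c' = c) ->
  pr (c + w) \notin fsum A (unbounded_residues pr W).
Proof.
move: hC => [_ _ [hi hhi] _] uniq; apply/negP => /imset2P[a r aA].
rewrite finset.inE => /asboolP rU e.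
(* Below [w], the new summand differs from [c]; below [c + w - hi], it is large enough to lie in
   [C]. *)
have [w' [Ww' pw' lt_w']] := rU (Num.min w (c + w - hi)).
have Cc' : C (c + w - w').
  by apply: hhi; [rewrite raddfB e pw' addrK|lia].
by have := uniq _ _ Cc' Ww' (subrK _ _); lia.
Qed.

(* A very negative integer can only be reached with a very negative w. *)
Lemma residue_cover {G : finZmodType} {pr : {additive int -> G}}
    {C W : set int} {A F : {set G}} :
  eventually_full pr C A F -> sumset C W = setT ->
  ~: fsum A (unbounded_residues pr W) \subset fsum F (unbounded_residues pr W).
Proof.
move=> [fib [lo hlo] _ hAF] CW; apply/fintype.subsetP => t; rewrite finset.inE => tN.
have [N hN] := unbounded_residuesP pr W.
have [z pz zN] := fib t (N + lo).
have [c Cc [w Ww e]] : sumset C W z by rewrite CW.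
have wU : pr w \in unbounded_residues pr W.
  by apply: hN => //; have := hlo _ Cc; lia.
have tE : t = pr c + pr w by rewrite -raddfD e pz.
have := hAF _ Cc; rewrite finset.inE => /orP[cA|cF].
  by case/negP: tN; apply/imset2P; exists (pr c) (pr w).
by apply/imset2P; exists (pr c) (pr w).
Qed.

(** * Residues reached from the classes of [A] by a single element of [W] *)

Definition isolated {G : finZmodType} (pr : int -> G) (A : {set G}) (W : set int)
    (t : G) (w : int) : Prop :=
  W w /\ forall w', W w' -> t - pr w' \in A -> w' = w.

Lemma int_min (D : set int) (N w : int) :
  (forall x, D x -> N <= x) -> D w -> exists2 x, D x & forall y, D y -> x <= y.
Proof.
move=> hN Dw; have exP : exists n : nat, `[< D (N + n%:Z) >].
  exists `|w - N|%N; apply/asboolP; have := hN _ Dw => le_N.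
  by rewrite (_ : _ + _ = w) //; lia.
have [n /asboolP Dn minn] := ex_minnP exP; exists (N + n%:Z) => // y Dy.
have le_N := hN _ Dy; have : (n <= `|y - N|)%N; last by lia.
by apply: minn; apply/asboolP; rewrite (_ : _ + _ = y) //; lia.
Qed.

(** If two elements of [W] led from [A] to [t], then for large [c] each would represent [c + w],
    against uniqueness. As [t] depends on [c], the threshold must be uniform in [t]. *)
Lemma isolated_exists {G : finZmodType} {pr : {additive int -> G}}
    {C W : set int} {A F : {set G}} :
  eventually_full pr C A F -> is_minimal_complement C W ->
  forall a, a \in A -> exists t w,
    [/\ t \notin fsum A (unbounded_residues pr W), pr w = t - a &
        isolated pr A W t w].
Proof.
move=> hC hCW a aA; have [fib _ [hi hhi] _] := hC.
set U := unbounded_residues pr W.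
have [N hN] := unbounded_residuesP pr W.
have [|K hK] := @uniform_threshold G (fun t x => t \notin fsum A U ->
    forall c w, c = x -> pr c \in A -> W w -> pr (c + w) = t ->
      (forall c' w', C c' -> W w' -> c' + w' = c + w -> c' = c) ->
    isolated pr A W t w).
  move=> t; set D : set int := [set w | W w /\ t - pr w \in A].
  have DN : t \notin fsum A U -> forall x, D x -> N <= x.
    move=> tN x [Wx tx]; rewrite leNgt; apply: contra tN => xN.
    by apply/imset2P; exists (t - pr x) (pr x); rewrite ?subrK //; apply: hN.
  (* Any element of D below w, or within c - hi above w, gives another
     representation of c + w. *)
  have key x c w : hi <= c + w - x -> D x -> W w -> pr (c + w) = t ->
      (forall c' w', C c' -> W w' -> c' + w' = c + w -> c' = c) -> x = w.
    move=> le_hi [Wx tx] Ww tE uniq.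
    have Cx : C (c + w - x) by apply: hhi => //; rewrite raddfB tE.
    by have := uniq _ _ Cx Wx (subrK _ _); lia.
  have [[tN [w0 Dw0]]|] := pselect (t \notin fsum A U /\ exists w, D w); last first.
    move=> nD; exists 0 => x _ tN c w _ cA Ww tE _; case: nD; split => //.
    by exists w; split => //; rewrite -tE raddfD addrK.
  have [m Dm minm] := int_min _ _ _ (DN tN) Dw0.
  have [[w1 [Dw1 ne]]|nw1] := pselect (exists w1, D w1 /\ w1 <> m).
    (* Since [m <= w] and [m <= w1], this bound puts both [c + w - m] and [c + w - w1] beyond [hi],
       so [m] and [w1] both equal [w]. *)
    exists (hi + w1 - m) => x le_x _ c w -> cA Ww tE uniq.
    have le1 := minm _ Dw1.
    have Dw : D w by split => //; rewrite -tE raddfD addrK.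
    have le2 := minm _ Dw.
    have e1 : m = w by apply: (key _ x w) => //; lia.
    by case: ne; rewrite e1; apply: (key _ x w) => //; lia.
  exists hi => x le_x _ c w -> cA Ww tE uniq.
  have Dw : D w by split => //; rewrite -tE raddfD addrK.
  split => // w' Ww' tw'.
  have eqm y : D y -> y = m by move=> Dy; apply: contrapT => ne; case: nw1; exists y.
  by rewrite (eqm w') // (eqm w).
(* Classes are only known to be unbounded below, so a large element of class [a] is obtained by
   negation. *)
have [z pz lt_z] := fib (- a) (- Num.max hi K).
have pc : pr (- z) = a by rewrite raddfN pz opprK.
have [|w Ww uniq] := unique_representation hCW (- z).
  by apply: hhi; [rewrite pc|lia].
exists (pr (- z + w)), w; have tN := unique_residue hC _ _ uniq; split => //.
  by rewrite raddfD pc addrAC subrr add0r.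
by apply: (hK _ (- z)) => //; [lia|rewrite pc].
Qed.

(** Isolation forces [x = w a], whose residue [t a - a] then forces [b = a]. This yields the
    injectivity of [t]. *)
Lemma isolated_shift_inj {G : finZmodType} {pr : {additive int -> G}}
    {W : set int} {A : {set G}} {t : G -> G} {w : G -> int} a b x :
  (forall a, a \in A -> pr (w a) = t a - a /\ isolated pr A W (t a) (w a)) ->
  a \in A -> b \in A -> W x -> t a - pr x = b -> a = b /\ x = w a.
Proof.
move=> h aA bA Wx e; have [pa [Wa isoa]] := h a aA.
have xE : x = w a by apply: isoa; rewrite ?e.
by split => //; rewrite -e xE pa opprB addrC subrK.
Qed.

Lemma complement_counting {G : finZmodType} {pr : {additive int -> G}}
    {C W : set int} {A F : {set G}}
    (hG : forall (S : {set G}) d, d != 0 -> S != finset.set0 ->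
       (forall x, x \in S -> x + d \in S) -> S = [set: G]%SET) :
  eventually_full pr C A F -> is_minimal_complement C W -> A != finset.set0 ->
  let U := unbounded_residues pr W in
  let T := (~: fsum A U)%SET in
  exists (t : G -> G) (w : G -> int),
    [/\ forall a, a \in A -> pr (w a) = t a - a /\ isolated pr A W (t a) (w a),
        [set t a | a in A]%SET \subset T,
        #|[set t a | a in A]%SET| = #|A|,
        (#|T| <= #|F| * #|U|)%N &
        (#|A| + #|U| + #|T| <= #|G|.+1)%N].
Proof.
move=> hC hCW A0 U T.
have /choice [tw htw] : forall a, exists tw : G * int, a \in A ->
    [/\ tw.1 \notin fsum A U, pr tw.2 = tw.1 - a & isolated pr A W tw.1 tw.2].
  move=> a; case: (boolP (a \in A)) => aA; last by exists (0, 0).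
  by have [t [w h]] := isolated_exists hC hCW a aA; exists (t, w).
set t := fun a => (tw a).1; set w := fun a => (tw a).2.
have htwA a : a \in A -> pr (w a) = t a - a /\ isolated pr A W (t a) (w a).
  by move=> /htw[].
have [a0 a0A] := finset.set0Pn _ A0.
have t0T : t a0 \in T by rewrite finset.inE; have [] := htw _ a0A.
have subT := residue_cover hC hCW.1.
(* [T] contains [t a0] and lies in [F + U], so [U] is nonempty. *)
have U0 : U != finset.set0.
  have /imset2P[f u _ uU _] := fintype.subsetP subT _ t0T.
  by apply/finset.set0Pn; exists u.
exists t, w; split => //.
- by apply/fintype.subsetP => _ /imsetP[a aA ->]; rewrite finset.inE; have [] := htw _ aA.
- apply: card_in_imset => a b aA bA e.
  have [pb [Wb _]] := htwA b bA.
  have eb : t a - pr (w b) = b by rewrite e pb opprB addrC subrK.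
  by have [] := isolated_shift_inj a b (w b) htwA aA bA Wb eb.
- apply: leq_trans (subset_leq_card subT) _.
  rewrite /fsum curry_imset2X; apply: leq_trans (leq_imset_card _ _) _.
  by rewrite cardsX.
- have ne : fsum A U != [set: G]%SET.
    by apply: contraTneq t0T => e; rewrite finset.inE e finset.inE.
  have cT : (#|fsum A U| + #|T| = #|G|)%N := cardsC (fsum A U).
  by have := cauchy_davenport hG A U A0 U0 ne; lia.
Qed.

(** For [x] of class [a] outside [C], a representation of [x + w a] starting in [A] would use [w a]
    and put [x] in [C], so it starts in [FS]. For [x] in [C], the witness of [x] must be [w a], so
    [x + w a] has no representation starting in [FS]. *)
Lemma gap_in_class {G : finZmodType} {pr : {additive int -> G}}
    {C W FS : set int} {A F : {set G}} {t : G -> G} {w : G -> int} a :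
  eventually_full pr C A F -> is_minimal_complement C W ->
  (forall c, FS c -> C c /\ pr c \notin A) ->
  (forall c, C c -> pr c \notin A -> FS c) ->
  (forall a, a \in A -> pr (w a) = t a - a /\ isolated pr A W (t a) (w a)) ->
  (forall r, r \notin fsum A (unbounded_residues pr W) ->
     exists2 b, b \in A & r = t b) ->
  a \in A ->
  pr @^-1` [set a] `&` ~` C =
  pr @^-1` [set a] `&` sumset FS [set x - w a | x in W].
Proof.
move=> hC hCW hFS hCF htw hT aA; have [pa [Wa isoa]] := htw a aA.
apply/seteqP; split => x [/= px].
- move=> nCx; split => //; have [c Cc [w' Ww' e]] : sumset C W (x + w a).
    by rewrite hCW.1.
  have [cA|cA] := boolP (pr c \in A); last first.
    exists c; first exact: hCF.
    by exists (w' - w a); [exists w'|rewrite addrA e addrK].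
  have ew : w' = w a.
    apply: isoa => //; suff -> : t a = pr (c + w') by rewrite raddfD addrK.
    by rewrite e raddfD px pa addrC subrK.
  by case: nCx; move: e; rewrite ew => /addIr <-.
- move=> [c Fc [_ [w' Ww' <-] e]]; split => // Cx.
  have [Cc cA] := hFS c Fc.
  have [w0 Ww0 uniq] := unique_representation hCW _ Cx.
  have [b bA tb] := hT _ (unique_residue hC _ _ uniq).
  have ea : t b - pr w0 = a by rewrite -tb raddfD px addrK.
  have [eb w0E] := isolated_shift_inj b a w0 htw bA aA Ww0 ea.
  have xE : c = x by apply: (uniq _ w' Cc Ww'); rewrite w0E eb -e; lia.
  by move: cA; rewrite xE px aA.
Qed.

(** * The prime modulus, and eventually periodic sets of integers *)

Lemma Zp_no_proper_translate (p : nat) (S : {set 'I_p.+2}) d :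
  prime p.+2 -> d != 0 -> S != finset.set0 ->
  (forall x, x \in S -> x + d \in S) -> S = [set: 'I_p.+2]%SET.
Proof.
move=> pp d0 /finset.set0Pn[s sS] hS.
have hSn k : s + d *+ k \in S.
  by elim: k => [|k IHk]; rewrite ?mulr0n ?addr0 // mulrSr addrA hS.
have dU : (d : 'Z_p.+2) \is a GRing.unit.
  rewrite -[d]natr_Zp unitZpE // prime_coprime //.
  have d_gt0 : (0 < d)%N.
    by rewrite lt0n; apply: contra d0 => /eqP e; apply/eqP/val_inj.
  by rewrite gtnNdvd ?ltn_ord.
apply/finset.setP => x; rewrite finset.in_setT.
(* As [d] is invertible, [(x - s) / d] steps of length [d] lead from [s] to [x]. *)
have -> : x = s + d *+ (nat_of_ord ((d : 'Z_p.+2)^-1 * (x - s))).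
  by rewrite -mulr_natr (natr_Zp ((d : 'Z_p.+2)^-1 * (x - s))) mulrA mulrV // mul1r addrC subrK.
exact: hSn.
Qed.

(** This makes the projection additive, as the general lemmas require. *)
Lemma Zproj_intr (p : nat) (x : int) : Zproj p.+2 x = x%:~R :> 'I_p.+2.
Proof.
have e : (x %% p.+2%:Z)%Z = `|(x %% p.+2%:Z)%Z|%N :> int.
  by rewrite gez0_abs // modz_ge0.
rewrite {2}(divz_eq x p.+2%:Z) intrD intrM.
rewrite (_ : (p.+2%:Z)%:~R = 0 :> 'I_p.+2); last exact: (@pchar_Zp p.+2).
by rewrite mulr0 add0r e -pmulrn /Zproj; apply/esym/(@Zp_nat p).
Qed.

Lemma Zproj_dvd (p : nat) (x : int) :
  x%:~R = 0 :> 'I_p.+2 -> exists k, x = p.+2%:Z * k.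
Proof.
rewrite -Zproj_intr => /(congr1 val) /= e.
have := ltz_pmod x (isT : 0 < p.+2%:Z); have := modz_ge0 x (isT : p.+2%:Z != 0).
move=> ge0 lt; move: e; rewrite modn_small; last by lia.
move=> e; exists (x %/ p.+2%:Z)%Z; rewrite {1}(divz_eq x p.+2%:Z); lia.
Qed.

Lemma finite_set_bounded (S : set int) :
  finite_set S -> exists K, forall x, S x -> `|x| <= K.
Proof.
move=> /finite_seqP [s ->]; exists (\sum_(x <- s) `|x|) => x /= xs.
by rewrite (big_rem x) //= lerDl sumr_ge0.
Qed.

Lemma finite_of_residues (m : nat) (A : set int) :
  (forall a a', A a -> A a' -> Zproj m a = Zproj m a' -> a = a') ->
  finite_set A.
Proof.
move=> inj; have /choice [rep hrep] : forall g : Zmod m, exists x, forall a,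
    A a -> Zproj m a = g -> a = x.
  move=> g; have [[a [Aa ag]]|nA] := pselect (exists a, A a /\ Zproj m a = g).
    by exists a => b Ab bg; apply: inj; rewrite ?bg.
  by exists 0 => a Aa ag; case: nA; exists a.
apply: (@sub_finite_set _ _ (rep @` setT)).
  by move=> a Aa; exists (Zproj m a) => //; rewrite -(hrep _ a).
exact/finite_image/finite_finset.
Qed.

Definition residue_set (m : nat) (S : set int) : {set Zmod m} :=
  [set x | x \in residues m S]%SET.

Lemma residue_setP (p : nat) (S : set int) (x : 'I_p.+2) :
  reflect (exists2 s, S s & s%:~R = x) (x \in residue_set p.+2 S).
Proof.
rewrite finset.inE; apply: (iffP idP) => [|[s Ss <-]].
  by rewrite inE => -[s Ss <-]; exists s; rewrite ?Zproj_intr.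
by rewrite inE; exists s; rewrite ?Zproj_intr.
Qed.

Lemma ep_eventually_full (p : nat) (A B F : set int) :
  ep_normalized p.+2 A B F ->
  eventually_full (intmul (1 : 'I_p.+2)) (ep_set p.+2 A B F)
    (residue_set p.+2 A) (residue_set p.+2 F).
Proof.
move=> [[_ _ [finB finF] BA _] _ injA _].
have p0 : (p.+2%:Z)%:~R = 0 :> 'I_p.+2 := @pchar_Zp p.+2 isT.
have [KA hKA] := finite_set_bounded _ (finite_of_residues _ _ injA).
have [KB hKB] := finite_set_bounded _ finB.
have [KF hKF] := finite_set_bounded _ finF.
split.
- move=> g N; exists ((val g)%:Z - p.+2%:Z * (`|N| + (val g)%:Z + 1)); last by nia.
  by rewrite intrB intrM p0 mul0r subr0 -pmulrn; apply: (natr_Zp (g : 'Z_p.+2)).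
- exists (- (`|KA| + `|KB| + `|KF|)) => c [[[_ [k _ <-] [a Aa <-]]|Bc]|Fc].
  + by have := hKA _ Aa; lia.
  + by have := hKB _ Bc; lia.
  + by have := hKF _ Fc; lia.
(* The [+ 1] makes [x - a] positive, since the multiples in [ep_set] start at [k = 1]. *)
- exists (KA + 1) => x /residue_setP[a Aa e] le_x; left; left.
  have [|k xE] := Zproj_dvd p (x - a); first by rewrite intrB e subrr.
  have := hKA _ Aa => leA; have k0 : 0 < k by nia.
  exists (x - a); last by exists a; rewrite ?subrK.
  by exists `|k|%N => /=; [lia|rewrite xE PoszM; lia].
- move=> c Cc; rewrite finset.in_setU; apply/orP.
  case: Cc => [[[_ [k _ <-] [a Aa <-]]|Bc]|Fc].
  + left; apply/residue_setP; exists a => //.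
    by rewrite intrD PoszM intrM p0 mul0r add0r.
  + have /BA [a Aa e] : residues p.+2 B (Zproj p.+2 c) by exists c.
    by left; apply/residue_setP; exists a; rewrite -?Zproj_intr.
  + by right; apply/residue_setP; exists c.
Qed.

Lemma ep_residue_F (p : nat) (A B F : set int) c :
  ep_normalized p.+2 A B F -> F c ->
  ep_set p.+2 A B F c /\ c%:~R \notin residue_set p.+2 A.
Proof.
move=> [[_ _ _ _ FA] _ _ _] Fc; split; first by right.
apply/negP => /residue_setP[a Aa e].
suff : (residues p.+2 F `&` residues p.+2 A) (Zproj p.+2 c) by rewrite FA.
by split; [exists c|exists a; rewrite ?Zproj_intr].
Qed.

Lemma ep_residue_notin_A (p : nat) (A B F : set int) c :
  ep_normalized p.+2 A B F -> ep_set p.+2 A B F c ->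
  c%:~R \notin residue_set p.+2 A -> F c.
Proof.
move=> [[_ _ _ BA _] _ _ _] [[[_ [k _ <-] [a Aa <-]]|Bc]|//] /negP[].
  apply/residue_setP; exists a => //.
  by rewrite intrD PoszM intrM [(Posz p.+2)%:~R](@pchar_Zp p.+2) // mul0r add0r.
have [a Aa e] : residues p.+2 A (Zproj p.+2 c) by apply: BA; exists c.
by apply/residue_setP; exists a; rewrite -?Zproj_intr.
Qed.

Theorem theorem6 (m : nat) (A B F C : set int)
    (hrep : ep_normalized m A B F) (hC : C = ep_set m A B F) :
  (prime m -> arises_as_minimal_complement C ->
     (#|residues m A|%:R : rat)
       <= #|residues m F|%:R / (2 * #|residues m F| + 1)%N%:R * (m + 1)%N%:R)
  /\
  (prime m -> arises_as_minimal_complement C ->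
     #|residues m F|%:R / (2 * #|residues m F| + 1)%N%:R * m%:R
       < (#|residues m A|%:R : rat) ->
     forall a : Zmod m, residues m A a ->
       exists W : set int,
         residue_class a `&` ~` C = residue_class a `&` sumset F W).
Proof.
(* Neither 0 nor 1 is prime. *)
case: m hrep hC => [|[|p]] hrep hC; try by split.
set AA := residue_set p.+2 A; set FF := residue_set p.+2 F.
have cA : #|residues p.+2 A| = #|AA| by rewrite cardsE.
have cF : #|residues p.+2 F| = #|FF| by rewrite cardsE.
have ZI : Zproj p.+2 = intmul (1 : 'I_p.+2) by apply/funext => x; exact: Zproj_intr.
have full := ep_eventually_full _ _ _ _ hrep; rewrite -hC in full.
have AA0 : AA != finset.set0.
  have [[_ [a Aa] _ _ _] _ _ _] := hrep.
  by apply/finset.set0Pn; exists a%:~R; apply/residue_setP; exists a.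
have key (pp : prime p.+2) W hW := @complement_counting _ (intmul (1 : 'I_p.+2))
  C W AA FF (fun S d => Zp_no_proper_translate p S d pp) full hW AA0.
(* Here [n], [f], [u], [k], [M] stand for the sizes of [A], [F], [U], [T] and the group. Multiply
   the last hypothesis by [f] and bound [f * u] below by [k]. *)
have arith1 n f u k M : (n <= k -> k <= f * u -> n + u + k <= M.+1 ->
    n * (2 * f + 1) <= f * (M + 1))%N by nia.
have arith2 n f u k M : (k <= f * u -> n + u + k <= M.+1 ->
    f * M < n * (2 * f + 1) -> k <= n)%N.
  by move=> le_k le_M lt_n; rewrite leqNgt; apply/negP => lt_k; nia.
have f0 : 0 < (2 * #|FF| + 1)%N%:R :> rat by rewrite ltr0n; lia.
rewrite cA cF; split => pp [W hW].
  have [t [w [_ sub cT le1 le2]]] := key pp W hW.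
  have := subset_leq_card sub; rewrite cT => le3.
  rewrite mulrAC ler_pdivlMr // -!natrM ler_nat.
  by move: le2; rewrite card_ord; exact: arith1 le3 le1.
move=> big a aA; have [t [w [htw sub cT le1 le2]]] := key pp W hW.
move: big; rewrite mulrAC ltr_pdivrMr // -!natrM ltr_nat => big.
move: le2; rewrite card_ord => le2.
have eT : [set t a | a in AA]%SET =
    (~: fsum AA (unbounded_residues (intmul (1 : 'I_p.+2)) W))%SET.
  by apply/eqP; rewrite eqEcard sub cT; exact: arith2 le1 le2 big.
(* The translate of [W] that moves [w a] to 0. *)
exists [set x - w a | x in W]; rewrite /residue_class ZI.
apply: (gap_in_class a full hW _ _ htw).
- by move=> c Fc; rewrite hC; apply: ep_residue_F hrep Fc.
- by move=> c; rewrite hC; apply: ep_residue_notin_A hrep.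
- by move=> r rN; apply/imsetP; rewrite eT finset.inE.
- by rewrite finset.inE; apply/asboolP.
Qed.
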